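(* Let $\mathcal{L}$ be a linear and complete residuated lattice with underlying set $L$, let $\mathcal{A}$ be a fuzzy finite automaton (FfA) over $\mathcal{L}$, let $\varepsilon\in L$ and $k\in\mathbb{N}\cup\{\infty\}$. The SoftStateReduction algorithm run on $(\mathcal{A},\varepsilon,k)$ terminates at least when $\mathcal{L}_\varepsilon$ is $\otimes$-locally finite or $k\in\mathbb{N}$, and it always returns a correct result when it terminates; that is, whenever it terminates, it returns an FfA $\mathcal{A}'$ such that $\mathbf{L}(\mathcal{A}')=_\varepsilon\mathbf{L}(\mathcal{A})$ if $k=\infty$, or $\mathbf{L}^{\leq k}(\mathcal{A}')=_\varepsilon\mathbf{L}^{\leq k}(\mathcal{A})$ otherwise, with the property that either $\mathcal{A}'$ has fewer states than $\mathcal{A}$ or $\mathcal{A}'=\mathcal{A}$.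
   Context: A residuated lattice is $\mathcal{L} = \langle L, \leq, \land, \lor, \otimes, \to, 0, 1\rangle$ where $\langle L,\leq,\land,\lor,0,1\rangle$ is a lattice with least element $0$ and greatest element $1$, $\langle L,\otimes,1\rangle$ is a commutative monoid with unit $1$, and $x \otimes y \leq z$ iff $x \leq (y \to z)$ for all $x,y,z\in L$. It is complete (respectively, linear) if the lattice is complete (respectively, linear). A fuzzy subset of a set $X$ is a function $X \to L$; a fuzzy relation on $X$ is a fuzzy subset of $X\times X$. Composition $\circ$ is sup-$\otimes$ composition: $f \circ g = \sup_x f(x)\otimes g(x) \in L$, $(f\circ r)(x) = \sup_y f(y)\otimes r(y,x)$, $(r\circ f)(x)=\sup_y r(x,y)\otimes f(y)$, $(r\circ s)(x,y)=\sup_z r(x,z)\otimes s(z,y)$, for fuzzy subsets $f,g$ and fuzzy relations $r,s$. $id_X(x,x)=1$, $id_X(x,y)=0$ for $x\neq y$. $\varepsilon$-notions, for $\varepsilon\in L$: $x \le_\varepsilon y$ iff $x\leq y$ or $x \leq \varepsilon$; $x =_\varepsilon y$ iff $x\le_\varepsilon y$ and $y \le_\varepsilon x$ (pointwise for fuzzy sets); $x\land_\varepsilon y = x\land y$ if $x\land y>\varepsilon$, else $\varepsilon$; $x\lor_\varepsilon y=x\lor y\lor\varepsilon$; $x\otimes_\varepsilon y = x\otimes y$ if $x \otimes y>\varepsilon$, else $\varepsilon$; $(x\to_\varepsilon y)=(x\lor\varepsilon\to y\lor\varepsilon)$; $\bigvee_\varepsilon A = \sup(A\cup\{\varepsilon\})$;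 $\bigwedge_\varepsilon A=\inf A$ if $\inf A>\varepsilon$, else $\varepsilon$ (pointwise for families of fuzzy sets). $\circ_\varepsilon$ is defined like $\circ$ with $\sup,\otimes$ replaced by $\bigvee_\varepsilon,\otimes_\varepsilon$. $(f/_{\varepsilon}\, g)(a,b)=(g(b)\to_\varepsilon f(a))$. The truncation $f_\varepsilon$ is $f_\varepsilon(a)=f(a)$ if $f(a)>\varepsilon$, else $\varepsilon$. $\mathcal{L}_\varepsilon=\langle L,\le_\varepsilon,\land_\varepsilon,\lor_\varepsilon,\otimes_\varepsilon,\to_\varepsilon,0,1\rangle$; it is $\otimes$-locally finite if for every finite $A\subseteq L$ the smallest subset of $L$ containing $A\cup\{1\}$ and closed under $\otimes_\varepsilon$ is finite. An FfA over $\mathcal{L}$ is $\mathcal{A}=\langle Q,\Sigma,I,\delta,F\rangle$ with finite nonempty state set $Q$, finite nonempty alphabet $\Sigma$, $I,F:Q\to L$, $\delta:Q\times\Sigma\times Q\to L$. $\delta_\epsilon=id_Q$ for the empty word $\epsilon$, $\delta_\sigma(p,q)=\delta(p,\sigma,q)$, $\delta_{\sigma u}=\delta_\sigma\circ\delta_u$; $I_w=I\circ\delta_w$, $F_w=\delta_w\circ F$. $\mathbf{L}(\mathcal{A})(w)=I\circ\delta_w\circ F$; for $k\in\mathbb{N}$, $\mathbf{L}^{\leq k}(\mathcal{A})(w)=\mathbf{L}(\mathcal{A})(w)$ if $|w|\leq k$, else $0$. A state $q$ is reachable if $I_w(q)>0$ for some $w\in \Sigma^*$, and productive if $F_w(q)>0$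 for some $w\in \Sigma^*$. The reverse $\mathcal{A}^{-1}$ has the same states and alphabet, initial set $F$, final set $I$ and transitions $\delta_\sigma^{-1}$ (where $r^{-1}(x,y)=r(y,x)$). Function ReductionByRightInvariance($\mathcal{A},\varepsilon,k$): 1. $\mathcal{F}:=\{F_\varepsilon\}$, $d\mathcal{F}:=\{F_\varepsilon\}$ (here $F_\varepsilon$ is the $\varepsilon$-truncation of $F$). 2. Repeat $k$ times: set $d\mathcal{F}_2:=\emptyset$; for each $f\in d\mathcal{F}$ and $\sigma\in\Sigma$, let $g:=\delta_\sigma\circ_\varepsilon f$, and if $g\notin\mathcal{F}$, insert $g$ into both $\mathcal{F}$ and $d\mathcal{F}_2$; then $d\mathcal{F}:=d\mathcal{F}_2$; if $d\mathcal{F}$ is empty, break. 3. $Z:=\bigwedge_\varepsilon\{f/_{\varepsilon}\, f\mid f\in\mathcal{F}\}$. 4. With $Z_q(p)=Z(q,p)$ and $Z^q(p)=Z(p,q)$, and $Q/Z:=\{Z_q\mid q\in Q\}$, let $d=|Q/Z|$ and choose states $q_1,\dots,q_d\in Q$ such that $Q/Z=\{Z_{q_1},\dots,Z_{q_d}\}$; let $Q'=\{q_1,\dots,q_d\}$, $I'(q)=I\circ_\varepsilon Z^q$, $F'(q)=Z_q\circ_\varepsilon F$, $\delta'_\sigma(p,q)=Z_p\circ_\varepsilon\delta_\sigma\circ_\varepsilon Z^q$ for $p,q\in Q'$, $\sigma\in\Sigma$. Return $\langle Q',\Sigma,I',\delta',F'\rangle$. Function SoftStateReduction$_0$($\mathcal{A},\varepsilon,k$):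 set $\mathcal{A}':=\mathcal{A}$. Loop: $\mathcal{A}_2:=$ ReductionByRightInvariance($\mathcal{A}',\varepsilon,k$); $\mathcal{A}_3:=$ (ReductionByRightInvariance($\mathcal{A}_2^{-1},\varepsilon,k$))$^{-1}$; if $\mathcal{A}_3$ has fewer states than $\mathcal{A}'$, set $\mathcal{A}':=\mathcal{A}_3$ and continue; otherwise return $\mathcal{A}'$. Algorithm SoftStateReduction($\mathcal{A},\varepsilon,k$): 1. Eliminate from $\mathcal{A}$ all unreachable or unproductive states. 2. $\mathcal{A}_2:=$ SoftStateReduction$_0$($\mathcal{A},\varepsilon,k$). 3. $\mathcal{A}_3:=$ (SoftStateReduction$_0$($\mathcal{A}^{-1},\varepsilon,k$))$^{-1}$. 4. Return $\mathcal{A}_2$ if $\mathcal{A}_2$ has fewer states than $\mathcal{A}_3$, else $\mathcal{A}_3$.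
   Formalization: The returned automaton may have an empty state set; it is shown to be nonempty only when some state of A is both reachable and productive, since otherwise step 1 eliminates every state and the output is not an FfA as defined. *)

(* Defs.v *)
From HB Require Import structures.
From mathcomp Require Import all_boot all_order.
From mathcomp Require Import all_classical.

Set Implicit Arguments.
Unset Strict Implicit.
Unset Printing Implicit Defensive.

Import Order.TTheory.
Local Open Scope order_scope.
Local Open Scope classical_set_scope.

(** * Residuated lattices *)

(* [\bot] and [\top] are the paper's 0 and 1; 0 = 1 is not excluded. *)
HB.mixin Record isResiduated d L of Order.TBLattice d L := {
  tensor : L -> L -> L;
  residuum : L -> L -> L;
  tensorA : associative tensor;
  tensorC : commutative tensor;
  tensor1x : left_id (\top : L) tensor;
  residuationP : forall x y z : L, (tensor x y <= z) = (x <= residuum y z)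
}.

#[short(type="residuatedLatticeType")]
HB.structure Definition ResiduatedLattice d :=
  { L of isResiduated d L & Order.TBLattice d L }.

Definition complete_lattice d (L : residuatedLatticeType d) : Prop :=
  forall A : set L, supremums A !=set0 /\ infimums A !=set0.

Definition linear_lattice d (L : residuatedLatticeType d) : Prop :=
  total (<=%O : rel L).

Section EpsilonOperations.
Variables (d : Order.disp_t) (L : residuatedLatticeType d).
Implicit Types (x y eps : L) (A : set L).

(* The default values are the suprema and infima of the empty set. *)
Definition sup A : L := supremum \bot A.
Definition inf A : L := infimum \top A.

Definition le_eps eps x y : Prop := x <= y \/ x <= eps.
Definition eq_eps eps x y : Prop := le_eps eps x y /\ le_eps eps y x.
Definition trunc eps x : L := if eps < x then x else eps.
Definition tensor_eps eps x y : L :=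
  if eps < tensor x y then tensor x y else eps.
Definition residuum_eps eps x y : L := residuum (x `|` eps)%O (y `|` eps)%O.
Definition sup_eps eps A : L := sup (A `|` [set eps]).
Definition inf_eps eps A : L := if eps < inf A then inf A else eps.

Definition tensor_closed eps (M : set L) : Prop :=
  forall x y, M x -> M y -> M (tensor_eps eps x y).

Definition tensor_locally_finite eps : Prop :=
  forall A, finite_set A ->
    finite_set (smallest (tensor_closed eps) (A `|` [set \top])).

End EpsilonOperations.

(** * Fuzzy sets and relations *)

(* The four compositions, parametrised by the supremum and the tensor, so that
   one definition serves for the plain and for the epsilon-compositions; the
   letters S and R tell whether each operand is a fuzzy set or a relation. *)
Section Composition.
Variables (L : Type) (Sup : set L -> L) (T : L -> L -> L) (X : Type).
Implicit Types (f g : X -> L) (r s : X -> X -> L).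

Definition gcompSS f g : L := Sup [set T (f x) (g x) | x in [set: X]].
Definition gcompSR f r x : L := Sup [set T (f y) (r y x) | y in [set: X]].
Definition gcompRS r f x : L := Sup [set T (r x y) (f y) | y in [set: X]].
Definition gcompRR r s x y : L := Sup [set T (r x z) (s z y) | z in [set: X]].

End Composition.

Section FuzzySets.
Variables (d : Order.disp_t) (L : residuatedLatticeType d).

Definition compSS X := gcompSS (X := X) (@sup d L) (@tensor d L).
Definition compSR X := gcompSR (X := X) (@sup d L) (@tensor d L).
Definition compRS X := gcompRS (X := X) (@sup d L) (@tensor d L).
Definition compRR X := gcompRR (X := X) (@sup d L) (@tensor d L).

Variable eps : L.
Definition compSS_eps X := gcompSS (X := X) (sup_eps eps) (tensor_eps eps).
Definition compSR_eps X := gcompSR (X := X) (sup_eps eps) (tensor_eps eps).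
Definition compRS_eps X := gcompRS (X := X) (sup_eps eps) (tensor_eps eps).
Definition compRR_eps X := gcompRR (X := X) (sup_eps eps) (tensor_eps eps).

Definition div_eps X (f g : X -> L) : X -> X -> L :=
  fun a b => residuum_eps eps (g b) (f a).

Definition idrel (X : eqType) : X -> X -> L :=
  fun x y => if x == y then \top else \bot.

End FuzzySets.

(** * Fuzzy finite automata *)

(* The state type may be empty: removing the useless states of an automaton
   can leave no state at all. *)
Record automaton d (L : residuatedLatticeType d) (Sigma : finType) := Automaton {
  state : finType;
  init : state -> L;
  delta : Sigma -> state -> state -> L;
  final : state -> L
}.

Section Automata.
Variables (d : Order.disp_t) (L : residuatedLatticeType d) (Sigma : finType).
Implicit Types (A : automaton L Sigma) (w : seq Sigma).

Definition nstates A : nat := #|state A|.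

Fixpoint delta_word A w {struct w} : state A -> state A -> L :=
  if w is s :: u then compRR (delta (a := A) s) (@delta_word A u)
  else @idrel d L (state A).

Definition init_word A w : state A -> L := compSR (init (a := A)) (delta_word (A := A) w).
Definition final_word A w : state A -> L := compRS (delta_word (A := A) w) (final (a := A)).

Definition language A w : L :=
  compSS (compSR (init (a := A)) (delta_word (A := A) w)) (final (a := A)).

Definition language_le (k : nat) A w : L :=
  if (size w <= k)%N then language A w else \bot.

Definition reachable A (q : state A) : Prop := exists w, \bot < init_word w q.
Definition productive A (q : state A) : Prop := exists w, \bot < final_word w q.
Definition useful A (q : state A) : Prop := reachable q /\ productive q.

Definition reverse A : automaton L Sigma :=
  Automaton (final (a := A)) (fun s p q => delta s q p) (init (a := A)).

(* Restriction to a subset P of the states. *)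
Definition subautomaton A (P : pred (state A)) : automaton L Sigma :=
  @Automaton d L Sigma {q : state A | P q} (fun q => init (val q))
    (fun s p q => delta s (val p) (val q)) (fun q => final (val q)).

(* When there is nothing to remove the result is A itself, and not its copy on
   the full subtype: this is what makes Leibniz equality of automata
   meaningful. *)
Definition remove_useless A : automaton L Sigma :=
  if `[< forall q : state A, useful q >] then A
  else subautomaton (fun q : state A => `[< useful q >]).

End Automata.

(** * Nondeterministic programs *)

(* A program is given by the set of results of its terminating executions,
   and by the proposition that all its executions terminate. *)
Record program (X : Type) := Program { returns : X -> Prop; halts : Prop }.

Definition ret X (x : X) : program X := Program (fun y => y = x) True.

Definition any_of X (P : X -> Prop) : program X := Program P True.

Definition bind X Y (m : program X) (f : X -> program Y) : program Y :=
  Program (fun y => exists2 x, returns m x & returns (f x) y)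
          (halts m /\ forall x, returns m x -> halts (f x)).

Notation "'do' x <- m ; p" := (bind m (fun x => p))
  (at level 200, x name, m at level 100, p at level 200).

(* [loop body s] runs [body s]; it goes on from s' if that returns [inl s'],
   and stops with result r if that returns [inr r]. *)
Inductive loop_returns S R (body : S -> program (S + R)) : S -> R -> Prop :=
| LoopStop s r : returns (body s) (inr r) -> loop_returns body s r
| LoopNext s s' r : returns (body s) (inl s') -> loop_returns body s' r ->
    loop_returns body s r.

Inductive loop_halts S R (body : S -> program (S + R)) : S -> Prop :=
| LoopHalts s : halts (body s) ->
    (forall s', returns (body s) (inl s') -> loop_halts body s') ->
    loop_halts body s.

Definition loop S R (body : S -> program (S + R)) (s : S) : program R :=
  Program (loop_returns body s) (loop_halts body s).

(** * The algorithm *)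

Section SoftStateReduction.
Variables (d : Order.disp_t) (L : residuatedLatticeType d) (Sigma : finType).
Variable eps : L.
(* [Some n] is the natural number n, and [None] is infinity. *)
Variable k : option nat.
Implicit Type A : automaton L Sigma.

(* One of the k passes, none of which depends on the order in which the pairs
   (f, sigma) are processed. The first component of the loop state is the number of
   passes still allowed. *)
Definition residual_family_pass A
    (c : option nat * set (state A -> L) * set (state A -> L)) :
    program (option nat * set (state A -> L) * set (state A -> L)
             + set (state A -> L)) :=
  let: (n, FF, dFF) := c in
  if n == Some 0%N then ret (inr FF) else
  let dFF2 := [set compRS_eps eps (delta s) f | s in [set: Sigma] & f in dFF]
              `\` FF in
  let FF2 := FF `|` dFF2 in
  if dFF2 == set0 then ret (inr FF2) else ret (inl (omap predn n, FF2, dFF2)).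

Definition residual_family A : program (set (state A -> L)) :=
  let F_eps := fun q => trunc eps (final (a := A) q) in
  loop (residual_family_pass (A := A)) (k, [set F_eps], [set F_eps]).

Definition right_invariance A (FF : set (state A -> L)) :
    state A -> state A -> L :=
  fun p q => inf_eps eps [set div_eps eps f f p q | f in FF].

(* Q' picks exactly one state for every element of Q/Z = {Z_q | q in Q}. *)
Definition representatives A (Z : state A -> state A -> L)
    (Q' : {set state A}) : Prop :=
  set_bij [set q | q \in Q'] (range Z) Z.

Definition quotient A (Z : state A -> state A -> L) (Q' : {set state A}) :
    automaton L Sigma :=
  let row q := Z q in
  let col q := fun p => Z p q in
  @Automaton d L Sigma {q : state A | q \in Q'}
    (fun q => compSS_eps eps (init (a := A)) (col (val q)))
    (fun s p q =>
       compSS_eps eps (compSR_eps eps (row (val p)) (delta s)) (col (val q)))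
    (fun q => compSS_eps eps (row (val q)) (final (a := A))).

Definition reduction_by_right_invariance A : program (automaton L Sigma) :=
  do FF <- residual_family A;
  let Z := right_invariance FF in
  do Q' <- any_of (representatives Z);
  ret (quotient Z Q').

Definition soft_state_reduction0_body A :
    program (automaton L Sigma + automaton L Sigma) :=
  do A2 <- reduction_by_right_invariance A;
  do B <- reduction_by_right_invariance (reverse A2);
  let A3 := reverse B in
  ret (if (nstates A3 < nstates A)%N then inl A3 else inr A).

Definition soft_state_reduction0 A : program (automaton L Sigma) :=
  loop soft_state_reduction0_body A.

Definition soft_state_reduction A : program (automaton L Sigma) :=
  let A1 := remove_useless A in
  do A2 <- soft_state_reduction0 A1;
  do B <- soft_state_reduction0 (reverse A1);
  let A3 := reverse B in
  ret (if (nstates A2 < nstates A3)%N then A2 else A3).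

(* L(A') =_eps L(A), or the same for the words of length at most k *)
Definition same_language A' A : Prop :=
  forall w : seq Sigma,
    if k is Some n then eq_eps eps (language_le n A' w) (language_le n A w)
    else eq_eps eps (language A' w) (language A w).

End SoftStateReduction.

(* Main.v *)
(** Over a linear lattice every epsilon-operation is the plain operation
    followed by a join with epsilon, x =_eps y means x `|` eps = y `|` eps, and
    this equivalence is a congruence for joins and tensor.

    The family computed by the algorithm contains F_w `|` eps for all words w
    allowed by k, hence its right invariance Z is reflexive and
    Z o F_w =_eps F_w. In this composition the sup may be restricted to the
    representatives, since Z p q = Z q p = 1 as soon as Z_p = Z_q. By induction
    on w, the quotient satisfies F'_w(q) =_eps F_w(q), which yields the equality
    of the languages.

    For k infinite and L_eps tensor-locally finite, the functions of the family
    take their values in the finite closure, under the epsilon-tensor, of the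
    entries of the automaton and epsilon, so the family cannot grow forever. *)
Require Import Defs.
From mathcomp Require Import all_boot all_order.
From mathcomp Require Import all_classical.

Set Implicit Arguments.
Unset Strict Implicit.
Unset Printing Implicit Defensive.

Import Order.TTheory.

(** * Residuated lattices: finite joins, and operations modulo [eps] *)

Section Lattice.
Variables (d : Order.disp_t) (L : residuatedLatticeType d).
Implicit Types (x y z eps : L).
Local Open Scope classical_set_scope.
Local Open Scope order_scope.

Lemma le_tensor x x' y y' :
  x <= x' -> y <= y' -> tensor x y <= tensor x' y'.
Proof.
move=> xx' yy'; rewrite residuationP (le_trans xx') //.
rewrite -residuationP tensorC residuationP (le_trans yy') //.
by rewrite -residuationP tensorC.
Qed.

Lemma tensorx1 x : tensor x \top = x.
Proof. by rewrite tensorC tensor1x. Qed.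

Lemma tensor0x x : tensor \bot x = \bot.
Proof. by apply/eqP; rewrite -lex0 residuationP le0x. Qed.

Lemma tensorx0 x : tensor x \bot = \bot.
Proof. by rewrite tensorC tensor0x. Qed.

Lemma tensor_lel x y : tensor x y <= x.
Proof. by rewrite -[leRHS]tensorx1 le_tensor. Qed.

Lemma tensor_joinl x y z :
  tensor (x `|` y) z = tensor x z `|` tensor y z.
Proof.
apply/le_anti/andP; split.
  by rewrite residuationP leUx -!residuationP leUl leUr.
by rewrite leUx !le_tensor ?leUl ?leUr.
Qed.

Lemma tensor_joinsl (I : finType) (f : I -> L) z :
  tensor (\join_i f i) z = \join_i tensor (f i) z.
Proof.
apply: (big_morph (fun x => tensor x z)); last exact: tensor0x.
by move=> x y; rewrite tensor_joinl.
Qed.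

Lemma tensor_joinsr (I : finType) (f : I -> L) z :
  tensor z (\join_i f i) = \join_i tensor z (f i).
Proof.
by rewrite tensorC tensor_joinsl; apply: eq_bigr => i _; rewrite tensorC.
Qed.

(** Associativity of the vector-matrix-vector product: [tensor] distributes over finite joins on
    both sides, and the two joins commute. *)
Lemma joins_tensorA (I J : finType) (f : I -> L) (r : I -> J -> L)
    (g : J -> L) :
  \join_j tensor (\join_i tensor (f i) (r i j)) (g j)
  = \join_i tensor (f i) (\join_j tensor (r i j) (g j)).
Proof.
under eq_bigr do rewrite tensor_joinsl.
rewrite exchange_big; apply: eq_bigr => i _.
by rewrite tensor_joinsr; apply: eq_bigr => j _; rewrite -tensorA.
Qed.

(** [supremum] picks some least upper bound, with default [\bot] on the empty set; antisymmetry
    identifies the choice. *)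
Lemma sup_unique (A : set L) x :
  ubound A x -> (forall y, ubound A y -> x <= y) -> sup A = x.
Proof.
move=> ubx lbx; rewrite /sup /supremum; case: eqP => [A0|_].
  by apply/le_anti; rewrite le0x lbx// A0.
case: xgetP => [y _ [uby lby]|/(_ x)]; last by case; split.
by apply/le_anti; rewrite lbx// lby.
Qed.

Lemma sup_joins (I : finType) (f : I -> L) :
  sup [set f i | i in [set: I]] = \join_i f i.
Proof.
apply: sup_unique => [_ [i _ <-]|y uby]; first exact: joins_sup.
by apply/joinsP => i _; apply: uby; exists i.
Qed.

Lemma compSSE (X : finType) (f g : X -> L) :
  compSS f g = \join_x tensor (f x) (g x).
Proof. exact: sup_joins. Qed.

Lemma compSRE (X : finType) (f : X -> L) (r : X -> X -> L) (x : X) :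
  compSR f r x = \join_y tensor (f y) (r y x).
Proof. exact: sup_joins. Qed.

Lemma compRSE (X : finType) (r : X -> X -> L) (f : X -> L) (x : X) :
  compRS r f x = \join_y tensor (r x y) (f y).
Proof. exact: sup_joins. Qed.

Lemma compRRE (X : finType) (r s : X -> X -> L) (x y : X) :
  compRR r s x y = \join_z tensor (r x z) (s z y).
Proof. exact: sup_joins. Qed.

Lemma joins_idrell (X : finType) (f : X -> L) (x : X) :
  \join_y tensor (idrel L x y) (f y) = f x.
Proof.
rewrite (bigD1 x)//= /idrel eqxx tensor1x big1 ?joinx0// => y.
by rewrite eq_sym => /negbTE ->; rewrite tensor0x.
Qed.

Lemma joins_idrelr (X : finType) (f : X -> L) (x : X) :
  \join_y tensor (f y) (idrel L y x) = f x.
Proof.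
rewrite -[RHS]joins_idrell; apply: eq_bigr => y _.
by rewrite tensorC /idrel eq_sym.
Qed.

Hypothesis Llinear : linear_lattice L.
Hypothesis Lcomplete : complete_lattice L.

Lemma inf_glb (A : set L) :
  lbound A (inf A) /\ forall y, lbound A y -> y <= inf A.
Proof.
rewrite /inf /infimum; case: eqP => [->|_].
  by split=> // y _; rewrite lex1.
have [_ [x infx]] := Lcomplete A.
by case: xgetP => [y _ [lby uby]|/(_ x)//]; split.
Qed.

(** This is where linearity enters: for [x] incomparable with [eps], [trunc] would give [eps] and
    not the join. *)
Lemma truncE eps x : trunc eps x = x `|` eps.
Proof.
rewrite /trunc; case: ifPn => [/ltW/join_l//|].
have /orP[xe _|ex] := Llinear x eps; first by rewrite join_r.
by rewrite lt_neqAle ex andbT negbK => /eqP <-; rewrite joinxx.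
Qed.

Lemma inf_epsE eps (A : set L) : inf_eps eps A = inf A `|` eps.
Proof. exact: truncE. Qed.

Lemma tensor_epsE eps x y : tensor_eps eps x y = tensor x y `|` eps.
Proof. exact: truncE. Qed.

(** By linearity the join of [y] and [eps] is one of the two, so [le_eps eps x y] says that [x] is
    below this join. *)
Lemma eq_epsP eps x y : eq_eps eps x y <-> x `|` eps = y `|` eps.
Proof.
have leE u v : le_eps eps u v <-> u <= v `|` eps.
  split=> [[uv|ue]|]; try by rewrite lexU2 ?uv ?ue ?orbT.
  by have /orP[/join_r ->|/join_l ->] := Llinear v eps; [right|left].
rewrite /eq_eps; split=> [[/leE xy /leE yx]|E]; last first.
  by split; apply/leE; [rewrite -E|rewrite E]; exact: leUl.
by apply/le_anti; rewrite !leUx xy yx !leUr.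
Qed.

(** After distributing, every product with a factor [eps] is below [eps], because the unit of
    [tensor] is the top element. *)
Lemma tensor_join_eps eps x y :
  tensor (x `|` eps) (y `|` eps) `|` eps = tensor x y `|` eps.
Proof.
apply/le_anti/andP; split; last first.
  by rewrite leUx leUr andbT (le_trans _ (leUl _ _))// le_tensor ?leUl.
rewrite leUx leUr andbT tensor_joinl leUx; apply/andP; split.
  rewrite tensorC tensor_joinl leUx tensorC leUl/=.
  exact: le_trans (tensor_lel _ _) (leUr _ _).
exact: le_trans (tensor_lel _ _) (leUr _ _).
Qed.

Lemma eq_tensor_eps eps x x' y y' : x `|` eps = x' `|` eps ->
  y `|` eps = y' `|` eps -> tensor x y `|` eps = tensor x' y' `|` eps.
Proof. by move=> ex ey; rewrite -tensor_join_eps ex ey tensor_join_eps. Qed.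

Lemma eq_joins_eps eps (I : finType) (f g : I -> L) :
  (forall i, f i `|` eps = g i `|` eps) ->
  (\join_i f i) `|` eps = (\join_i g i) `|` eps.
Proof.
move=> fg; apply/le_anti; rewrite !leUx !leUr !andbT.
apply/andP; split; apply/joinsP => i _.
  by rewrite (le_trans (leUl _ eps))// fg leUx leUr andbT lexU2// joins_sup.
by rewrite (le_trans (leUl _ eps))// -fg leUx leUr andbT lexU2// joins_sup.
Qed.

Lemma sup_eps_joins eps (I : finType) (f : I -> L) :
  sup_eps eps [set f i | i in [set: I]] = (\join_i f i) `|` eps.
Proof.
apply: sup_unique => [x [[i _ <-]|->]|y uby].
- by rewrite lexU2// joins_sup.
- exact: leUr.
- rewrite leUx; apply/andP; split; last by apply: uby; right.
  by apply/joinsP => i _; apply: uby; left; exists i.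
Qed.

Lemma sup_eps_tensor eps (I : finType) (f g : I -> L) :
  sup_eps eps [set tensor_eps eps (f i) (g i) | i in [set: I]]
  = (\join_i tensor (f i) (g i)) `|` eps.
Proof.
rewrite sup_eps_joins; apply: eq_joins_eps => i.
by rewrite tensor_epsE -joinA joinxx.
Qed.

Lemma compSS_epsE eps (X : finType) (f g : X -> L) :
  compSS_eps eps f g = (\join_x tensor (f x) (g x)) `|` eps.
Proof. exact: sup_eps_tensor. Qed.

Lemma compSR_epsE eps (X : finType) (f : X -> L) (r : X -> X -> L) (x : X) :
  compSR_eps eps f r x = (\join_y tensor (f y) (r y x)) `|` eps.
Proof. exact: sup_eps_tensor. Qed.

Lemma compRS_epsE eps (X : finType) (r : X -> X -> L) (f : X -> L) (x : X) :
  compRS_eps eps r f x = (\join_y tensor (r x y) (f y)) `|` eps.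
Proof. exact: sup_eps_tensor. Qed.

End Lattice.

(** * Languages by recursion on words, reversal, removal of useless states *)

Section Automata.
Variables (d : Order.disp_t) (L : residuatedLatticeType d) (Sigma : finType).
Implicit Types (A : automaton L Sigma) (v w : seq Sigma).
Local Open Scope classical_set_scope.
Local Open Scope order_scope.

Lemma delta_word_cons A s w (p q : state A) :
  delta_word (s :: w) p q = \join_r tensor (delta s p r) (delta_word w r q).
Proof. exact: compRRE. Qed.

Lemma final_word0 A (q : state A) : final_word [::] q = final q.
Proof. by rewrite /final_word compRSE joins_idrell. Qed.

Lemma final_word_cons A s w (p : state A) :
  final_word (s :: w) p = \join_q tensor (delta s p q) (final_word w q).
Proof.
rewrite /final_word compRSE; under eq_bigr do rewrite delta_word_cons.
by rewrite joins_tensorA; apply: eq_bigr => q _; rewrite compRSE.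
Qed.

Lemma languageE A w :
  language A w = \join_(q : state A) tensor (init q) (final_word w q).
Proof.
rewrite /language compSSE; under eq_bigr do rewrite compSRE.
by rewrite joins_tensorA; apply: eq_bigr => q _; rewrite /final_word compRSE.
Qed.

Lemma init_word0 A (q : state A) : init_word [::] q = init q.
Proof. by rewrite /init_word compSRE joins_idrelr. Qed.

(** [delta_word] recurses on the first letter; peeling off the last one serves [init_word] and
    reversal. *)
Lemma delta_word_rcons A w s (p q : state A) :
  delta_word (rcons w s) p q
  = \join_r tensor (delta_word w p r) (delta s r q).
Proof.
elim: w p q => [|t w IHw] p q.
  by rewrite delta_word_cons joins_idrelr joins_idrell.
rewrite rcons_cons delta_word_cons.
under eq_bigr do rewrite IHw.
rewrite -joins_tensorA.
by under [RHS]eq_bigr do rewrite delta_word_cons.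
Qed.

Lemma init_word_rcons A w s (q : state A) :
  init_word (rcons w s) q = \join_p tensor (init_word w p) (delta s p q).
Proof.
rewrite /init_word compSRE; under eq_bigr do rewrite delta_word_rcons.
by rewrite -joins_tensorA; apply: eq_bigr => r _; rewrite compSRE.
Qed.

Lemma delta_word_reverse A w (p q : state A) :
  @delta_word _ _ _ (reverse A) (rev w) p q = delta_word w q p.
Proof.
elim: w p q => [|s w IHw] p q.
  by rewrite /= /idrel eq_sym.
rewrite rev_cons delta_word_cons delta_word_rcons.
by apply: eq_bigr => r _; rewrite IHw tensorC.
Qed.

Lemma language_reverse A w : language (reverse A) (rev w) = language A w.
Proof.
rewrite /language !compSSE.
under eq_bigr do rewrite compSRE.
rewrite joins_tensorA.
under [RHS]eq_bigr do rewrite compSRE tensorC.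
apply: eq_bigr => p _; congr tensor.
by apply: eq_bigr => q _; rewrite delta_word_reverse tensorC.
Qed.

Lemma reverseK : involutive (@reverse d L Sigma).
Proof. by case. Qed.

Lemma joins_sub (X : finType) (P : pred X) (f : X -> L) :
  (forall x, ~~ P x -> f x = \bot) ->
  \join_(x : {x : X | P x}) f (val x) = \join_x f x.
Proof.
move=> fP; apply/le_anti/andP; split; apply/joinsP => x _.
  exact: joins_sup.
have [Px|/fP ->] := boolP (P x); last exact: le0x.
exact: (@joins_sup _ _ _ (exist _ x Px) xpredT (fun x => f (val x))).
Qed.

(** If both factors were nonzero, [v] and [w] would witness that [q] is useful. *)
Lemma useless_bot A v w (q : state A) :
  ~ useful q -> tensor (init_word v q) (final_word w q) = \bot.
Proof.
move=> uq; have [->|I0] := eqVneq (init_word v q) \bot.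
  exact: tensor0x.
have [->|F0] := eqVneq (final_word w q) \bot; first exact: tensorx0.
by case: uq; split; [exists v|exists w]; rewrite lt0x.
Qed.

Lemma final_word_sub A (P : pred (state A)) w (q : state (subautomaton P)) :
  final_word w q <= final_word w (val q).
Proof.
elim: w q => [|s w IHw] q; first by rewrite !final_word0.
rewrite !final_word_cons; apply/joinsP => p _.
by apply: le_trans (joins_sup (j := val p) _ _); rewrite ?le_tensor.
Qed.

Lemma language_remove_useless A w :
  language (remove_useless A) w = language A w.
Proof.
rewrite /remove_useless; case: ifP => // _.
set P : pred (state A) := fun q => `[< useful q >].
set B := subautomaton P.
(* The prefix [v] is read in [A] and the suffix [w] in the restriction [B], so that the induction
   can move letters from [w] to [v]. The case [v = [::]] compares the languages. *)
suff key v : \join_(q : state B) tensor (init_word v (val q)) (final_word w q)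
    = \join_(q : state A) tensor (init_word v q) (final_word w q).
  rewrite !languageE; have := key [::].
  under eq_bigr do rewrite init_word0.
  by under [X in _ = X -> _]eq_bigr do rewrite init_word0.
elim: w v => [|s w IHw] v.
  rewrite -[RHS](joins_sub (P := P)).
    by apply: eq_bigr => q _; rewrite !final_word0.
  by move=> q /asboolPn; exact: useless_bot.
under eq_bigr do rewrite final_word_cons.
under [RHS]eq_bigr do rewrite final_word_cons.
rewrite -!joins_tensorA.
under [RHS]eq_bigr do rewrite -init_word_rcons.
rewrite -IHw; apply: eq_bigr => q _.
rewrite init_word_rcons !tensor_joinsl -[RHS](joins_sub (P := P))//.
move=> p /asboolPn up.
(* Continuing in [B] weighs at most as much as continuing in [A], so the term through the useless
   state [p] is below one that [useless_bot] annihilates. *)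
apply/eqP; rewrite -lex0 -(useless_bot v (s :: w) up) -tensorA le_tensor//.
rewrite final_word_cons (le_trans _ (joins_sup (j := val q) _ _))//.
by rewrite le_tensor// final_word_sub.
Qed.

End Automata.

(** * The quotient by a right invariant relation preserves the language *)

Section Reduction.
Variables (d : Order.disp_t) (L : residuatedLatticeType d) (Sigma : finType).
Variables (eps : L) (k : option nat).
Implicit Types (A : automaton L Sigma) (w : seq Sigma).
Hypothesis Llinear : linear_lattice L.
Hypothesis Lcomplete : complete_lattice L.
Local Open Scope classical_set_scope.
Local Open Scope order_scope.

Definition size_le_opt w : bool :=
  if k is Some n then (size w <= n)%N else true.

(** On words longer than the bound, both truncated languages are [\bot]. *)
Lemma same_languageP A' A :
  same_language eps k A' A <-> forall w, size_le_opt w ->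
    language A' w `|` eps = language A w `|` eps.
Proof.
rewrite /same_language /size_le_opt /language_le.
split=> same w; move: (same w).
  by case: k => [n|] + /= => [+ wn|+ _]; rewrite ?wn => /eq_epsP; apply.
case: k => [n|] /=; last by move=> /(_ isT) E; apply/eq_epsP.
by case: leqP => [_ /(_ isT) E|_ _]; apply/eq_epsP.
Qed.

Lemma same_language_refl A : same_language eps k A A.
Proof. exact/same_languageP. Qed.

Lemma same_language_trans B A C :
  same_language eps k A B -> same_language eps k B C -> same_language eps k A C.
Proof.
move=> /same_languageP AB /same_languageP BC; apply/same_languageP => w kw.
by rewrite AB// BC.
Qed.

Lemma same_language_reverse A' A : same_language eps k A' A ->
  same_language eps k (reverse A') (reverse A).
Proof.
move=> /same_languageP same; apply/same_languageP => w kw.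
rewrite -(revK w) !language_reverse same//.
by rewrite /size_le_opt size_rev.
Qed.

Section Quotient.
Variables (A : automaton L Sigma) (Z : state A -> state A -> L).
Variable Q' : {set state A}.
Hypothesis Zrefl : forall p, Z p p = \top.
Hypothesis Zfinal : forall w, size_le_opt w -> forall p q,
  tensor (Z p q) (final_word w q) <= final_word w p `|` eps.
Hypothesis Q'P : representatives Z Q'.

Lemma joins_Z_final w p : size_le_opt w ->
  (\join_q tensor (Z p q) (final_word w q)) `|` eps = final_word w p `|` eps.
Proof.
move=> kw; apply/le_anti; rewrite !leUx !leUr !andbT; apply/andP; split.
  by apply/joinsP => q _; exact: Zfinal.
rewrite lexU2// (le_trans _ (joins_sup (j := p) _ _))//.
by rewrite Zrefl tensor1x.
Qed.

(* The sup is attained at the representative q of p: as Z_p = Z_q, both Z p q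
   and Z q p are 1. *)
Lemma joins_Z_final_repr w p : size_le_opt w ->
  (\join_(q : {q | q \in Q'}) tensor (Z p (val q)) (final_word w (val q)))
    `|` eps
  = final_word w p `|` eps.
Proof.
move=> kw; apply/le_anti; rewrite !leUx !leUr !andbT; apply/andP; split.
  by apply/joinsP => q _; exact: Zfinal.
have [_ _ /(_ (Z p)) []] := Q'P; first by exists p.
move=> q qQ' Zqp.
have Zpq : Z p q = \top by rewrite -Zqp Zrefl.
have -> : final_word w p = tensor (Z q p) (final_word w p).
  by rewrite Zqp Zrefl tensor1x.
rewrite (le_trans (Zfinal kw _ _))// leUx leUr andbT lexU2//.
apply/orP; left; apply: le_trans (joins_sup (j := exist _ q qQ') _ _) => //=.
by rewrite Zpq tensor1x.
Qed.

(** Modulo [eps], the vector of [s :: w] is rewritten as Z delta_s F_w and then as Z delta_s Z F_w,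
    where the last Z has its columns restricted to [Q']. This is a transition of the quotient
    followed by the induction hypothesis. *)
Lemma final_word_quotient w (q : state (quotient eps Z Q')) : size_le_opt w ->
  final_word w q `|` eps = final_word w (val q) `|` eps.
Proof.
elim: w q => [|s w IHw] q kw.
  rewrite final_word0 /= compSS_epsE// -joinA joinxx -(joins_Z_final _ kw).
  by under [in RHS]eq_bigr do rewrite final_word0.
have kw' : size_le_opt w.
  by move: kw; rewrite /size_le_opt; case: k => //= n /ltnW.
rewrite final_word_cons.
rewrite -(joins_Z_final _ kw); under [in RHS]eq_bigr do rewrite final_word_cons.
rewrite -joins_tensorA.
(* The same product without the truncations inside the quotient transitions, which the congruence
   modulo [eps] absorbs. *)
transitivity ((\join_(p : {q | q \in Q'}) tensor
    (\join_r tensor (\join_t tensor (Z (val q) t) (delta s t r)) (Z r (val p)))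
    (final_word w (val p))) `|` eps).
  apply: eq_joins_eps => p; apply: eq_tensor_eps; last exact: IHw.
  rewrite /= compSS_epsE// -joinA joinxx; apply: eq_joins_eps => r.
  by apply: eq_tensor_eps => //; rewrite compSR_epsE// -joinA joinxx.
rewrite [X in X `|` _ = _]joins_tensorA.
apply: eq_joins_eps => r; apply: eq_tensor_eps => //.
exact: joins_Z_final_repr.
Qed.

Lemma quotient_same_language : same_language eps k (quotient eps Z Q') A.
Proof.
apply/same_languageP => w kw; rewrite !languageE.
transitivity ((\join_(q : {q | q \in Q'}) tensor
    (\join_p tensor (init p) (Z p (val q))) (final_word w (val q))) `|` eps).
  apply: eq_joins_eps => q; apply: eq_tensor_eps.
    by rewrite /= compSS_epsE// -joinA joinxx.
  exact: final_word_quotient.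
rewrite joins_tensorA; apply: eq_joins_eps => p; apply: eq_tensor_eps => //.
exact: joins_Z_final_repr.
Qed.

Lemma nstates_quotient : nstates (quotient eps Z Q') = #|Q'|.
Proof. exact: card_sig. Qed.

Lemma nstates_quotient_gt0 : (0 < nstates A)%N ->
  (0 < nstates (quotient eps Z Q'))%N.
Proof.
move=> /card_gt0P[p _]; rewrite nstates_quotient; apply/card_gt0P.
by have [_ _ /(_ (Z p)) []] := Q'P; [exists p|move=> q qQ' _; exists q].
Qed.

End Quotient.

(** The result of [pick] depends only on the extension of its predicate, so states with equal rows
    share the same [rep]. *)
Lemma representatives_exist A (Z : state A -> state A -> L) :
  exists Q', representatives Z Q'.
Proof.
pose rep p := odflt p [pick q | `[< Z q = Z p >]].
have repE p : Z (rep p) = Z p.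
  by rewrite /rep; case: pickP => //= q /asboolP.
have rep_eq p q : Z p = Z q -> rep p = rep q.
  move=> E; rewrite /rep (eq_pick (_ : _ =1 fun r => `[< Z r = Z q >])).
    by case: pickP => //= /(_ q); rewrite (asboolT (erefl _)).
  by move=> r; rewrite /= E.
exists [set rep p | p : state A]%SET; split.
- by move=> p _; exists p.
- move=> p q; rewrite !inE => /imsetP[p' _ ->] /imsetP[q' _ ->].
  by rewrite !repE => /rep_eq.
- move=> _ [p _ <-]; exists (rep p); last exact: repE.
  by apply/imsetP; exists p.
Qed.

Section RightInvariance.
Variables (A : automaton L Sigma) (FF : set (state A -> L)).

Lemma right_invariance_refl p : right_invariance eps FF p p = \top.
Proof.
rewrite /right_invariance inf_epsE//; apply/eqP; rewrite -le1x lexU2//.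
have [_ ->//] := inf_glb Lcomplete [set div_eps eps f f p p | f in FF].
by move=> _ [f _ <-]; rewrite -residuationP tensor1x.
Qed.

Lemma right_invariance_tensor f p q : FF f ->
  tensor (right_invariance eps FF p q) (f q) <= f p `|` eps.
Proof.
move=> FFf; rewrite (le_trans (le_tensor (lexx _) (leUl _ eps)))//.
(* [inf_eps] is a join: its infimum half is bounded by the residuum for [f], its [eps] half by
   [tensor_lel]. *)
rewrite residuationP /right_invariance inf_epsE// leUx.
rewrite -[X in _ && X]residuationP (le_trans (tensor_lel _ _)) ?leUr// andbT.
have [lb _] := inf_glb Lcomplete [set div_eps eps f f p q | f in FF].
by apply: lb; exists f.
Qed.

End RightInvariance.

End Reduction.

(** * Rules for existence of results, partial correctness and termination *)

Section Programs.

(** [halts] alone promises no result: [any_of P] halts even when nothing satisfies [P]. *)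
Definition total X (m : program X) : Prop := halts m -> exists x, returns m x.

Lemma total_bind X Y (m : program X) (f : X -> program Y) :
  total m -> (forall x, total (f x)) -> total (bind m f).
Proof.
move=> tm tf [/tm[x mx] /(_ x mx) /tf[y fxy]].
by exists y, x.
Qed.

Lemma total_loop S R (body : S -> program (S + R)) s :
  (forall s, total (body s)) -> total (loop body s).
Proof.
move=> tb; elim=> {}s /tb[[s'|r] bs] _ IH; last by exists r; apply: LoopStop.
by have [r ?] := IH _ bs; exists r; apply: LoopNext bs _.
Qed.

Lemma loop_invariant S R (body : S -> program (S + R))
    (Inv : S -> Prop) (Post : R -> Prop) s r :
  (forall s s', Inv s -> returns (body s) (inl s') -> Inv s') ->
  (forall s r, Inv s -> returns (body s) (inr r) -> Post r) ->
  Inv s -> returns (loop body s) r -> Post r.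
Proof.
move=> step stop + run; elim: run => {s r} [s r bs Is|s s' r bs _ IH Is].
  exact: stop bs.
exact/IH/(step _ _ Is).
Qed.

Lemma loop_halts_variant S R (body : S -> program (S + R))
    (Inv : S -> Prop) (mu : S -> nat) s :
  (forall s, Inv s -> halts (body s)) ->
  (forall s s', Inv s -> returns (body s) (inl s') ->
    Inv s' /\ (mu s' < mu s)%N) ->
  Inv s -> halts (loop body s).
Proof.
move=> hb step; have [n] := ubnP (mu s).
elim: n s => [s|n IHn s]; first by rewrite ltn0.
rewrite ltnS => mus Is; constructor; first exact: hb.
move=> s' /(step _ _ Is)[Is' mus']; apply: IHn Is'.
exact: leq_trans mus' mus.
Qed.

End Programs.

(** * The computed family of residuals: what it contains, and when it is finite *)

Section ResidualFamily.
Variables (d : Order.disp_t) (L : residuatedLatticeType d) (Sigma : finType).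
Variables (eps : L) (k : option nat) (A : automaton L Sigma).
Hypothesis Llinear : linear_lattice L.
Implicit Types (FF dFF : set (state A -> L)) (w : seq Sigma).
Local Open Scope order_scope.
Local Open Scope classical_set_scope.

Definition new_residuals FF dFF : set (state A -> L) :=
  [set compRS_eps eps (delta s) f | s in [set: Sigma] & f in dFF] `\` FF.

Lemma residual_family_pass_next n FF dFF c :
  returns (residual_family_pass eps (n, FF, dFF)) (inl c) ->
  [/\ n <> Some 0%N, new_residuals FF dFF !=set0 &
      c = (omap predn n, FF `|` new_residuals FF dFF, new_residuals FF dFF)].
Proof.
rewrite /residual_family_pass; case: eqP => // n0.
rewrite -/(new_residuals FF dFF).
by case: eqP => // /eqP/set0P dFF0 [].
Qed.

Lemma residual_family_pass_stop n FF dFF r :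
  returns (residual_family_pass eps (n, FF, dFF)) (inr r) ->
  r = FF /\ (n = Some 0%N \/ new_residuals FF dFF = set0).
Proof.
rewrite /residual_family_pass; case: eqP => [n0 [->]|_].
  by split; [|left].
rewrite -/(new_residuals FF dFF).
by case: eqP => // dFF0 [->]; rewrite dFF0 setU0; split; [|right].
Qed.

Lemma halts_residual_family_pass c :
  halts (residual_family_pass (A := A) eps c).
Proof. by case: c => [[n FF] dFF]; rewrite /=; do 2?case: ifP. Qed.

Lemma total_residual_family_pass c :
  total (residual_family_pass (A := A) eps c).
Proof.
move=> _; case: c => [[n FF] dFF]; rewrite /=.
by case: ifP; last case: ifP; eexists.
Qed.

(** Truncating after each letter agrees with truncating once at the end, by congruence modulo
    [eps]. *)
Lemma trunc_final_cons s w :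
  compRS_eps eps (delta s) (fun q => final_word w q `|` eps)%O
  = (fun q : state A => final_word (s :: w) q `|` eps)%O.
Proof.
apply/funext => p; rewrite compRS_epsE// final_word_cons.
by apply: eq_joins_eps => q; apply: eq_tensor_eps; rewrite -?joinA ?joinxx.
Qed.

Lemma residual_familyP FF w : returns (residual_family eps k A) FF ->
  size_le_opt k w -> FF (fun q => final_word w q `|` eps)%O.
Proof.
move=> run; move: w.
pose T w := (fun q : state A => final_word w q `|` eps)%O.
(* After [i] passes, the words of length at most [i] are covered, and only members of the frontier
   [dFF] may lack a successor in [FF]; [n] is what remains of [k]. *)
pose Inv (c : option nat * set (state A -> L) * set (state A -> L)) :=
  let: (n, FF, dFF) := c in
  exists i, [/\ n = omap (subn^~ i) k,
    forall w, (size w <= i)%N -> FF (T w) &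
    forall f s, FF f -> dFF f \/ FF (compRS_eps eps (delta s) f)].
apply: (loop_invariant (Inv := Inv)
  (Post := fun FF => forall w, size_le_opt k w -> FF (T w))) run.
- move=> [[n {}FF] dFF] _ [i [nE FFT succ]] /residual_family_pass_next[_ _ ->].
  have succ' f s : FF f ->
      (FF `|` new_residuals FF dFF) (compRS_eps eps (delta s) f).
    move=> FFf; have [dFFf|] := succ f s FFf; last by left.
    have [|nFF] := pselect (FF (compRS_eps eps (delta s) f)); first by left.
    by right; split=> //; exists s => //; exists f.
  exists i.+1; split.
  + by rewrite nE; case: (k) => //= K; rewrite subnS.
  + move=> [|s w] /= wi; first by left; exact: FFT.
    by rewrite -[T _]trunc_final_cons; apply/succ'/FFT.
  + by move=> f s [/succ'|]; [right|left].
- move=> [[n {}FF] dFF] r [i [nE FFT succ]] /residual_family_pass_stop[->].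
  (* An exhausted counter means that [i] has reached [k]. If nothing new appears, [FF] is closed
     under successors, and induction covers words of every length. *)
  case=> [n0|new0].
    move=> w kw; apply: FFT; move: kw nE; rewrite n0 /size_le_opt.
    case: (k) => //= K wK [/esym/eqP]; rewrite subn_eq0.
    exact: leq_trans.
  move=> w _; elim: w => [|s w IHw]; first exact: FFT.
  rewrite -[T _]trunc_final_cons; apply: contrapT => nFF.
  have [dFFw|//] := succ _ s IHw.
  suff : set0 (compRS_eps eps (delta s) (T w)) by [].
  by rewrite -new0; split=> //; exists s => //; exists (T w).
- have T0 : T [::] = (fun q => trunc eps (final q)).
    by apply/funext => q; rewrite /T final_word0 truncE.
  exists 0%N; split.
  + by case: (k) => //= K; rewrite subn0.
  + by move=> [] // _; rewrite T0.
  + by move=> f s FFf; left.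
Qed.

Lemma halts_residual_family_finite : k <> None ->
  halts (residual_family eps k A).
Proof.
move=> kfin.
(* The variant is the counter; its value at [None] is a dummy that the invariant excludes. *)
apply: (loop_halts_variant (Inv := fun c => c.1.1 <> None)
  (mu := fun c => if c.1.1 is Some n then n else 0%N)) => //.
  by move=> c _; exact: halts_residual_family_pass.
move=> [[n FF] dFF] _ /= nfin /residual_family_pass_next[n0 _ ->] /=.
by case: n nfin n0 => [[|n]|] // _ _; split.
Qed.

(** Each pass that continues adds a function with values in [V], so the number of such functions
    still missing decreases. Coding them as finite functions into [seq_sub vs] makes that number a
    cardinal. *)
Lemma halts_residual_family_closed (V : set L) : finite_set V ->
  (forall q : state A, V (trunc eps (final q))) ->
  (forall s f, (forall q : state A, V (f q)) ->
    forall q, V (compRS_eps eps (delta s) f q)) ->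
  halts (residual_family eps k A).
Proof.
move=> /finite_seqP[vs ->] Vfinal Vsucc.
pose g (c : {ffun state A -> seq_sub vs}) q : L := ssval (c q).
have gsurj f : (forall q, f q \in vs) -> exists c, f = g c.
  move=> fvs; exists [ffun q => SeqSub (fvs q)].
  by apply/funext => q; rewrite /g ffunE.
apply: (loop_halts_variant
  (Inv := fun c => c.2 `<=` [set f | forall q, f q \in vs])
  (mu := fun c => #|[set h | `[< ~ c.1.2 (g h) >]]%SET|)).
- by move=> c _; exact: halts_residual_family_pass.
- move=> [[n FF] dFF] _ /= dFFvs /residual_family_pass_next[_ [f newf] ->].
  have newvs : new_residuals FF dFF `<=` [set f | forall q, f q \in vs].
    by move=> _ [[s _ [h dFFh <-]] _] q; apply: Vsucc; exact: dFFvs.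
  split=> //=; apply/proper_card/properP; split.
    apply/fintype.subsetP => h; rewrite !inE => nh FFh.
    by apply: nh; left.
  have [h fE] := gsurj _ (newvs _ newf).
  exists h; rewrite !inE -fE; first by case: newf.
  by apply/asboolPn => nf; apply: nf; right.
- by move=> _ -> q; exact: Vfinal.
Qed.

Lemma halts_residual_family_locally_finite : tensor_locally_finite eps ->
  halts (residual_family eps k A).
Proof.
move=> Lfin.
(* [eps] is a generator because it is the truncation of the empty join. *)
pose G : set L := (range (fun t : Sigma * state A * state A =>
    delta t.1.1 t.1.2 t.2)
  `|` range (fun q : state A => trunc eps (final q))) `|` [set eps].
have Gfin : finite_set G.
  rewrite !finite_setU; split; last exact: finite_set1.
  by split; apply: finite_image.
pose V := smallest (tensor_closed eps) (G `|` [set \top]).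
have GV x : G x -> V x by move=> Gx; apply: sub_gen_smallest; left.
have Veps : V eps by apply: GV; right.
have Vclosed : tensor_closed eps V.
  move=> x y Vx Vy W WG; have [closedW _] := WG.
  by apply: closedW; [exact: Vx|exact: Vy].
apply: (halts_residual_family_closed (Lfin _ Gfin)) => [q|s f Vf p].
  by apply: GV; left; right; exists q.
rewrite -/V compRS_epsE//.
(* The property carried along is that the join with [eps] lies in [V]; by linearity a binary join is
   one of its arguments, so closure under [tensor_eps] suffices. *)
elim/big_ind: _ => [|x y Vx Vy|q _]; first by rewrite join0x.
  by case/orP: (Llinear x y) => [/join_r ->|/join_l ->].
rewrite -tensor_epsE//; apply: Vclosed; last exact: Vf.
by apply: GV; left; left; exists (s, p, q).
Qed.

End ResidualFamily.

(** * Correctness and termination of the whole algorithm *)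

Section SoftStateReduction.
Variables (d : Order.disp_t) (L : residuatedLatticeType d) (Sigma : finType).
Variables (eps : L) (k : option nat).
Implicit Types (A B : automaton L Sigma).
Hypothesis Llinear : linear_lattice L.
Hypothesis Lcomplete : complete_lattice L.

(** The type of automata allows an empty state set, so nonemptiness has to be carried along. *)
Definition sound_reduction A B : Prop :=
  same_language eps k B A /\ ((0 < nstates A)%N -> (0 < nstates B)%N).

Lemma sound_reduction_refl A : sound_reduction A A.
Proof. by split=> //; exact: same_language_refl. Qed.

Lemma sound_reduction_trans B A C :
  sound_reduction A B -> sound_reduction B C -> sound_reduction A C.
Proof.
move=> [AB nAB] [BC nBC]; split; last by move=> /nAB.
exact: same_language_trans BC AB.
Qed.

Lemma sound_reduction_reverse A B :
  sound_reduction A B -> sound_reduction (reverse A) (reverse B).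
Proof. by case=> AB nAB; split=> //; exact: same_language_reverse. Qed.

Lemma reduction_by_right_invariance_sound A B :
  returns (reduction_by_right_invariance eps k A) B -> sound_reduction A B.
Proof.
move=> [FF runFF [Q' Q'P ->]]; split; last exact: nstates_quotient_gt0.
apply: quotient_same_language => // [p|w kw p q].
  exact: right_invariance_refl.
(* The family holds truncations only: [eps] is joined to the vector on the left, and the doubled
   [eps] on the right absorbs it. *)
rewrite -[X in (_ `|` X)%O]joinxx joinA.
apply: le_trans (le_tensor (lexx _) (leUl _ eps)) _.
have FFw := residual_familyP Llinear runFF kw.
exact: (right_invariance_tensor eps Llinear Lcomplete p q FFw).
Qed.

Lemma total_reduction_by_right_invariance A :
  total (reduction_by_right_invariance eps k A).
Proof.
apply: total_bind => [|FF].
  by apply: total_loop; exact: total_residual_family_pass.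
apply: total_bind => [_|Q' _]; first exact: representatives_exist.
by eexists.
Qed.

Lemma soft_state_reduction0_body_next A B :
  returns (soft_state_reduction0_body eps k A) (inl B) ->
  sound_reduction A B /\ (nstates B < nstates A)%N.
Proof.
move=> [A2 /reduction_by_right_invariance_sound AA2].
move=> [C /reduction_by_right_invariance_sound A2C] /=.
case: ifP => // lt_nstates [->]; split=> //.
apply: sound_reduction_trans AA2 _; rewrite -[A2]reverseK.
exact: sound_reduction_reverse.
Qed.

Lemma soft_state_reduction0_body_stop A B :
  returns (soft_state_reduction0_body eps k A) (inr B) -> B = A.
Proof. by move=> [A2 _ [C _]] /=; case: ifP => // _ []. Qed.

Lemma total_soft_state_reduction0 A : total (soft_state_reduction0 eps k A).
Proof.
apply: total_loop => B; apply: total_bind => [|A2].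
  exact: total_reduction_by_right_invariance.
apply: total_bind => [|C _]; first exact: total_reduction_by_right_invariance.
by eexists.
Qed.

(** Invariant and postcondition coincide, as the last iteration returns the automaton it started
    from. *)
Lemma soft_state_reduction0_sound A B :
  returns (soft_state_reduction0 eps k A) B ->
  sound_reduction A B /\ ((nstates B < nstates A)%N \/ B = A).
Proof.
pose Inv C := sound_reduction A C /\ ((nstates C < nstates A)%N \/ C = A).
apply: (loop_invariant (Inv := Inv) (Post := Inv)).
- move=> C D [AC ltCA] /soft_state_reduction0_body_next[CD ltDC]; split.
    exact: sound_reduction_trans CD.
  by left; case: ltCA => [|<-//]; exact: ltn_trans.
- by move=> C D AC /soft_state_reduction0_body_stop ->.
- by split; [exact: sound_reduction_refl|right].
Qed.

Lemma remove_useless_sound A :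
  same_language eps k (remove_useless A) A.
Proof. by apply/same_languageP => // w _; rewrite language_remove_useless. Qed.

Lemma nstates_remove_useless A :
  (nstates (remove_useless A) < nstates A)%N \/ remove_useless A = A.
Proof.
rewrite /remove_useless; case: ifPn => [_|/asboolPn]; first by right.
rewrite -existsNP => -[q uq]; left; rewrite /nstates card_sig.
apply/proper_card/properP; split; first exact/fintype.subsetP.
by exists q => //; apply/asboolPn.
Qed.

Lemma nstates_remove_useless_gt0 A (q : state A) : useful q ->
  (0 < nstates (remove_useless A))%N.
Proof.
move=> uq; rewrite /remove_useless; case: ifP => _; apply/card_gt0P.
  by exists q.
by exists (exist _ q (asboolT uq)).
Qed.

Lemma halts_residual_family A : tensor_locally_finite eps \/ k <> None ->
  halts (residual_family eps k A).
Proof.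
case=> [Lfin|kfin]; last exact: halts_residual_family_finite.
exact: halts_residual_family_locally_finite.
Qed.

Lemma halts_reduction_by_right_invariance A :
  tensor_locally_finite eps \/ k <> None ->
  halts (reduction_by_right_invariance eps k A).
Proof. by move=> fin; split; first exact: halts_residual_family. Qed.

(** The loop continues only after a strict drop in the number of states. *)
Lemma halts_soft_state_reduction0 A : tensor_locally_finite eps \/ k <> None ->
  halts (soft_state_reduction0 eps k A).
Proof.
move=> fin; apply: (loop_halts_variant (Inv := fun=> True)
  (mu := @nstates _ _ _)).
- move=> B _; split; first exact: halts_reduction_by_right_invariance.
  by move=> C _; split; first exact: halts_reduction_by_right_invariance.
- by move=> B C _ /soft_state_reduction0_body_next[_ ltBC].
- by [].
Qed.

End SoftStateReduction.

(** The second clause keeps the third from being vacuous. Nonemptiness of the result is conditional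
    on a useful state, since [remove_useless] may leave no state. *)
Theorem theorem6p3 (d : Order.disp_t) (L : residuatedLatticeType d)
    (Llinear : linear_lattice L) (Lcomplete : complete_lattice L)
    (Sigma : finType) (Sigma_nonempty : (0 < #|Sigma|)%N)
    (A : automaton L Sigma) (A_nonempty : (0 < nstates A)%N)
    (eps : L) (k : option nat) :
  (* termination *)
  (tensor_locally_finite eps \/ k <> None ->
     halts (soft_state_reduction eps k A))
  (* a terminating run yields a result *)
  /\ (halts (soft_state_reduction eps k A) ->
      exists A', returns (soft_state_reduction eps k A) A')
  (* every result is correct *)
  /\ (forall A', returns (soft_state_reduction eps k A) A' ->
      [/\ same_language eps k A' A,
          (nstates A' < nstates A)%N \/ A' = A
        & (exists q : state A, useful q) -> (0 < nstates A')%N]).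
Proof.
split; [|split].
- move=> fin; split; first exact: halts_soft_state_reduction0.
  by move=> B _; split; first exact: halts_soft_state_reduction0.
- apply: total_bind => [|A2]; first exact: total_soft_state_reduction0.
  apply: total_bind => [|B _]; first exact: total_soft_state_reduction0.
  by eexists.
move=> A' [A2 /(soft_state_reduction0_sound Llinear Lcomplete)[soundA2 ltA2]].
move=> [B /(soft_state_reduction0_sound Llinear Lcomplete)[soundB ltB]] A'E.
have [soundA' ltA'] : sound_reduction eps k (remove_useless A) A' /\
    ((nstates A' < nstates (remove_useless A))%N \/ A' = remove_useless A).
  rewrite A'E; case: ifP => _ //; split.
    by rewrite -[remove_useless A]reverseK; exact: sound_reduction_reverse.
  by case: ltB => [?|->]; [left|right; rewrite reverseK].
have [sameA' gt0A'] := soundA'; split.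
- exact: same_language_trans sameA' (remove_useless_sound _ _ Llinear _).
(* Equality with [A] survives only if neither the removal nor the reduction changed anything;
   otherwise the strict inequalities compose. *)
- case: (nstates_remove_useless A) ltA' => [ltA [ltA'|->]|->//]; last by left.
  by left; exact: ltn_trans ltA' ltA.
- by move=> [q /nstates_remove_useless_gt0].
Qed.
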